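(* Every discrete ballean is $\lambda$-rigid.
   Context: A coarse structure on a set $X$ is a family $\mathcal{E}$ of subsets of $X\times X$ such that: each $E\in\mathcal{E}$ contains the diagonal $\triangle_X=\{(x,x):x\in X\}$; if $E,E'\in\mathcal{E}$ then $E\circ E'\in\mathcal{E}$ and $E^{-1}\in\mathcal{E}$, where $E\circ E'=\{(x,y):\exists z\,((x,z)\in E,\ (z,y)\in E')\}$ and $E^{-1}=\{(y,x):(x,y)\in E\}$; if $E\in\mathcal{E}$ and $\triangle_X\subseteq E'\subseteq E$ then $E'\in\mathcal{E}$; and $\bigcup\mathcal{E}=X\times X$. The pair $(X,\mathcal{E})$ is called a ballean (or coarse space). For $E\in\mathcal{E}$, $x\in X$, $A\subseteq X$: $E[x]=\{y\in X:(x,y)\in E\}$ and $E[A]=\bigcup_{a\in A}E[a]$. A subset $B\subseteq X$ is bounded if $B\subseteq E[x]$ for some $E\in\mathcal{E}$, $x\in X$; otherwise it is unbounded. Subsets $A,B$ of $X$ are close, written $A\,\delta_{(X,\mathcal{E})}\,B$, if there is $E\in\mathcal{E}$ with $A\subseteq E[B]$ and $B\subseteq E[A]$. They are linked, written $A\,\lambda_{(X,\mathcal{E})}\,B$, if either both $A,B$ are bounded or there exist unbounded subsets $A'\subseteq A$, $B'\subseteq B$ that are close. A ballean $(X,\mathcal{E})$ is discrete if for every $E\in\mathcal{E}$ there is a bounded subset $B$ such that $E[x]=\{x\}$ for each $x\in X\setminus B$. A ballean $(X,\mathcal{E})$ is $\lambda$-rigid if for every coarse structure $\mathcal{E}'$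 on $X$ with $\lambda_{(X,\mathcal{E})}=\lambda_{(X,\mathcal{E}')}$ we have $\mathcal{E}=\mathcal{E}'$. *)

(* Defs.v *)
From mathcomp Require Import all_boot.
From mathcomp Require Import boolp classical_sets.

Set Implicit Arguments.
Unset Strict Implicit.
Unset Printing Implicit Defensive.

Local Open Scope classical_set_scope.
Local Open Scope relation_scope.

(* The library composition is written in reverse order: [E' \; E] is the set
   of (x, y) such that (x, z) is in E and (z, y) is in E' for some z.  *)
Record coarse_structure (X : Type) (EE : set (set (X * X))) : Prop := {
  coarse_diag : forall E, EE E -> diagonal `<=` E;
  coarse_comp : forall E E', EE E -> EE E' -> EE (E' \; E);
  coarse_inv : forall E, EE E -> EE E^-1;
  coarse_sub : forall E E', EE E -> diagonal `<=` E' -> E' `<=` E -> EE E';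
  coarse_cover : \bigcup_(E in EE) E = [set: X * X]
}.

(* The ball E[x] is [xsection E x]. *)
Definition ball_set (X : Type) (E : set (X * X)) (A : set X) : set X :=
  \bigcup_(a in A) xsection E a.

Definition bounded (X : Type) (EE : set (set (X * X))) (B : set X) : Prop :=
  exists E x, EE E /\ B `<=` xsection E x.

Definition close (X : Type) (EE : set (set (X * X))) (A B : set X) : Prop :=
  exists E, [/\ EE E, A `<=` ball_set E B & B `<=` ball_set E A].

Definition linked (X : Type) (EE : set (set (X * X))) (A B : set X) : Prop :=
  (bounded EE A /\ bounded EE B) \/
  exists A' B', [/\ A' `<=` A, B' `<=` B,
    ~ bounded EE A', ~ bounded EE B' & close EE A' B'].

Definition discrete_ballean (X : Type) (EE : set (set (X * X))) : Prop :=
  forall E, EE E ->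
    exists2 B, bounded EE B & forall x, ~ B x -> xsection E x = [set x].

Definition lambda_rigid (X : Type) (EE : set (set (X * X))) : Prop :=
  forall EE' : set (set (X * X)),
    coarse_structure EE' -> linked EE = linked EE' -> EE = EE'.

(* Main.v *)
Require Import Defs.
From mathcomp Require Import all_boot.
From mathcomp Require Import boolp classical_sets.

(** The bounded sets are those linked to the empty set, so the linkedness
relation determines them. The discrete ballean is the smallest coarse structure
with its bounded sets, and in it two disjoint unbounded sets are never linked.
Conversely, let [E] be a symmetric entourage of a coarse structure such that
the set [S] of points incident to a non-loop edge of [E] is unbounded. If [I]
is a maximal independent set of the graph [E], then [S] minus [I] and [S & I] are
disjoint, and they are close because every point of one has a neighbour in the
other. So they are unbounded and linked, which a coarse structure with the
linkedness of a discrete one forbids: all its entourages are trivial off a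
bounded set. *)

Set Implicit Arguments.
Unset Strict Implicit.
Unset Printing Implicit Defensive.

Local Open Scope classical_set_scope.
Local Open Scope relation_scope.

(** Zorn's lemma applies because two points of the union of a chain already lie in one member. A
    point outside the maximal [I] without a neighbour in [I] could be added to it. *)
Lemma maximal_independent_set {X : Type} (E : set (X * X)) :
  (forall x y, E (x, y) -> E (y, x)) ->
  exists I : set X,
    (forall x y, I x -> I y -> E (x, y) -> x = y) /\
    (forall x, ~ I x -> exists y, [/\ I y, x <> y & E (x, y)]).
Proof.
move=> symE.
pose indep (I : set X) := forall x y, I x -> I y -> E (x, y) -> x = y.
have [F Findep Ftot|I [indI maxI]] := @Zorn_bigcup X indep.
  move=> x y [A FA Ax] [B FB By].
  have [AB|BA] := Ftot _ _ FA FB.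
  - exact: (Findep _ FB) (AB _ Ax) By.
  - exact: (Findep _ FA) Ax (BA _ By).
exists I; split=> // x nIx; apply: contrapT => noy.
have Ex y : I y -> E (x, y) -> x = y.
  by move=> Iy Exy; apply: contrapT => xy; apply: noy; exists y.
apply: (maxI (x |` I)).
  by split=> [y Iy|sub]; [right|apply: nIx; apply: sub; left].
move=> a b [->|Ia] [->|Ib] // Eab.
- exact: Ex.
- by apply/esym/Ex => //; exact: symE.
- exact: indI.
Qed.

Section CoarseStructure.
Context {X : Type} {EE : set (set (X * X))} (coarse_EE : coarse_structure EE).

Lemma entourage_refl E x : EE E -> E (x, x).
Proof. by move=> EEE; exact: (coarse_diag coarse_EE EEE). Qed.

Lemma bounded_subset (A B : set X) : A `<=` B -> bounded EE B -> bounded EE A.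
Proof.
by move=> AB [E [x [EEE BE]]]; exists E, x; split=> //; exact: subset_trans BE.
Qed.

Lemma bounded_ball_set E A : EE E -> bounded EE A -> bounded EE (ball_set E A).
Proof.
move=> EEE [F [x [EEF AF]]]; exists (E \; F), x.
split; first exact: (coarse_comp coarse_EE).
move=> y [a /AF /xsectionP Fxa /xsectionP Eay].
by apply/xsectionP; exists a.
Qed.

Lemma bounded_setU A B : bounded EE A -> bounded EE B -> bounded EE (A `|` B).
Proof.
move=> [F [x [EEF AF]]] [G [y [EEG BG]]].
have : [set: X * X] (x, y) by [].
rewrite -(coarse_cover coarse_EE) => -[H EEH Hxy].
have EEGH : EE (G \; H) by exact: (coarse_comp coarse_EE).
exists ((G \; H) \; F), x; split; first exact: (coarse_comp coarse_EE).
move=> z [/AF|/BG] /xsectionP Fz; apply/xsectionP.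
  by exists z => //; exact: entourage_refl.
by exists x; [exact: entourage_refl|exists y].
Qed.

Lemma bounded_set0 : X -> bounded EE set0.
Proof.
move=> x; have : [set: X * X] (x, x) by [].
by rewrite -(coarse_cover coarse_EE) => -[E EEE _]; exists E, x; split.
Qed.

Lemma linked_set0 (A : set X) : X -> linked EE A set0 <-> bounded EE A.
Proof.
move=> x; split=> [[[]//|[A' [B' [_ B'0 _ nbB' _]]]]|bA].
- by case: nbB'; exact: bounded_subset B'0 (bounded_set0 x).
- by left; split=> //; exact: bounded_set0.
Qed.

(** Two points of [B] are joined through the centre [z] of a ball containing [B]. *)
Lemma entourage_trivial_off_bounded (B : set X) E :
  bounded EE B -> diagonal `<=` E ->
  (forall x y, E (x, y) -> x <> y -> B x /\ B y) -> EE E.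
Proof.
move=> [F [z [EEF BF]]] diagE EB.
apply: (@coarse_sub _ _ coarse_EE (F \; F^-1)) => //.
  exact: (coarse_comp coarse_EE (coarse_inv coarse_EE EEF) EEF).
move=> [x y] Exy; have [<-|xy] := pselect (x = y).
  by have Fxx := entourage_refl x EEF; exists x.
have [/BF /xsectionP Fzx /BF /xsectionP Fzy] := EB _ _ Exy xy.
by exists z.
Qed.

Lemma unbounded_moved_split E :
  EE E -> (forall x y, E (x, y) -> E (y, x)) ->
  ~ bounded EE [set x | exists2 y, x <> y & E (x, y)] ->
  exists A B : set X,
    [/\ A `&` B = set0, ~ bounded EE A, ~ bounded EE B & close EE A B].
Proof.
move=> EEE symE; set S := [set x | _] => nbS.
have [I [indI domI]] := maximal_independent_set symE.
have AE : S `\` I `<=` ball_set E (S `&` I).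
  move=> x [_ nIx]; have [y [Iy xy Exy]] := domI x nIx.
  exists y; last by apply/xsectionP; exact: symE.
  by split=> //; exists x; [exact: nesym xy|exact: symE].
have BE : S `&` I `<=` ball_set E (S `\` I).
  move=> x [[y xy Exy] Ix]; exists y; last by apply/xsectionP; exact: symE.
  split; first by exists x; [exact: nesym xy|exact: symE].
  by move=> Iy; apply: xy; exact: indI.
have sub_ball A : A `<=` ball_set E A.
  by move=> x Ax; exists x => //; apply/xsectionP; exact: entourage_refl.
exists (S `\` I), (S `&` I); split.
- by rewrite -subset0 => x [[_ nIx] [_ Ix]].
(* Each of the two pieces has an [E]-ball covering [S], so it cannot be bounded. *)
- move=> /(bounded_ball_set EEE); apply: contra_not nbS.
  apply: bounded_subset => x Sx; have [Ix|nIx] := pselect (I x).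
  + exact: BE.
  + exact: sub_ball.
- move=> /(bounded_ball_set EEE); apply: contra_not nbS.
  apply: bounded_subset => x Sx; have [Ix|nIx] := pselect (I x).
  + exact: sub_ball.
  + exact: AE.
- by exists E; split.
Qed.

Hypothesis discrete_EE : discrete_ballean EE.

(** Discreteness puts only the source of a non-loop edge into the bounded set; passing to its
    [E]-ball catches the target too. *)
Lemma discrete_entourage E : EE E ->
  exists2 B, bounded EE B & forall x y, E (x, y) -> x <> y -> B x /\ B y.
Proof.
move=> EEE; have [B bB EB] := discrete_EE EEE.
exists (ball_set E B); first exact: bounded_ball_set.
move=> x y Exy xy.
have Bx : B x.
  apply: contrapT => /EB Ex; apply: xy; apply/esym.
  by have /xsectionP := Exy; rewrite Ex.
by split; exists x => //; apply/xsectionP => //; exact: entourage_refl.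
Qed.

(** The entourage witnessing closeness moves points only within a bounded set [C], so a point of
    [A'] outside [C] is itself in [B']. *)
Lemma discrete_linked_setI (A B : set X) :
  linked EE A B -> ~ bounded EE A -> ~ bounded EE (A `&` B).
Proof.
move=> [[bA _] /(_ bA)//|[A' [B' [A'A B'B nbA' _ [E [EEE A'E _]]]]]] _ bAB.
have [C bC EC] := discrete_entourage EEE.
apply: nbA'; apply: bounded_subset (bounded_setU bC bAB) => a A'a.
have [b B'b /xsectionP Eba] := A'E a A'a.
have [ba|ba] := pselect (b = a); last by have [_ Ca] := EC _ _ Eba ba; left.
by right; split; [exact: A'A|rewrite -ba; exact: B'B].
Qed.

End CoarseStructure.

Theorem corollary2 (X : Type) (EE : set (set (X * X)))
    (coarse_EE : coarse_structure EE) (discrete_EE : discrete_ballean EE) :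
  lambda_rigid EE.
Proof.
move=> EE' coarse_EE' lEE; apply/seteqP.
(* On an empty [X] no set is bounded, as a ball needs a centre. There [linked] on [set0] only tells
   whether the family has a member, and the empty relation is the only candidate. *)
have [[x0]|noX] := pselect (inhabited X); last first.
  have nb D A : ~ @bounded X D A by move=> [_ [x _]]; exact: noX (inhabits x).
  have sub (D D' : set (set (X * X))) :
      coarse_structure D' -> linked D = linked D' -> D `<=` D'.
    move=> cD' lD E DE.
    have : linked D set0 set0.
      by right; exists set0, set0; split=> //; exists E; split.
    rewrite lD => -[[/nb]//|[_ [_ [_ _ _ _ [F [D'F _ _]]]]]].
    by apply: (coarse_sub cD' D'F) => -[x]; case: noX.
  by split; exact: sub.
have bEE A : bounded EE A <-> bounded EE' A.
  by rewrite -(linked_set0 coarse_EE) // lEE linked_set0.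
split=> E.
  move=> EEE; have [B /bEE bB EB] := discrete_entourage coarse_EE discrete_EE EEE.
  apply: (entourage_trivial_off_bounded coarse_EE') EB => //.
  exact: (coarse_diag coarse_EE).
move=> EE'E; have diagE := coarse_diag coarse_EE' EE'E.
(* [F] is symmetric and contains the reflexive [E], so a bound on the points moved by [F] also
   serves for [E]. *)
pose F := E^-1 \; E.
have EE'F : EE' F by exact: (coarse_comp coarse_EE' _ (coarse_inv coarse_EE' _)).
have symF x y : F (x, y) -> F (y, x) by move=> [z Exz Eyz]; exists z.
have [bS|nbS] := pselect (bounded EE' [set x | exists2 y, x <> y & F (x, y)]).
  move/bEE: bS => /(entourage_trivial_off_bounded coarse_EE); apply=> //.
  move=> x y Exy xy; have Fxy : F (x, y) by exists y => //; exact: diagE.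
  by split; [exists y|exists x; [exact: nesym xy|exact: symF]].
have [A [B [AB0 nbA nbB clAB]]] := unbounded_moved_split coarse_EE' EE'F symF nbS.
have lAB : linked EE A B by rewrite lEE; right; exists A, B; split.
have := discrete_linked_setI coarse_EE discrete_EE lAB.
by rewrite AB0 => /(_ (contra_not (bEE A).1 nbA)) []; exact: bounded_set0.
Qed.
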